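(* Let $F$ be a free group of finite rank $r$ with free basis $X=\{x_1,\ldots,x_r\}$, let $N$ be a normal subgroup of $F$, and let $\theta:F\to F/N$ be the quotient homomorphism. Then the Magnus embedding $\varphi$ (defined by Fox derivatives) and the geometric Magnus embedding $\varphi_{\mathrm{geo}}$ are equivalent: for every $w\in F$, $\varphi(w)=(f^{(w)},\theta(w))$ and $\varphi_{\mathrm{geo}}(w)=(P_w,\theta(w))$ are the same element of $\mathbb{Z}^r\wr F/N$, i.e. $f^{(w)}=P_w$. Here $f^{(w)}$ and $P_w$ are as defined in the context.
   Context: Wreath product: for groups $A,B$, let $A^{(B)}$ be the group of finitely supported functions $B\to A$ under pointwise multiplication; $A\wr B=A^{(B)}\rtimes B$ consists of pairs $(f,b)$ with $(f,b)(g,c)=(fg^b,bc)$, $g^b(x)=g(b^{-1}x)$. Fox derivatives: for each $i$, $\frac{\partial}{\partial x_i}:\mathbb{Z}(F)\to\mathbb{Z}(F)$ is the unique additive map with $\frac{\partial (ab)}{\partial x_i}=\frac{\partial a}{\partial x_i}\varepsilon(b)+a\frac{\partial b}{\partial x_i}$ for all $a,b\in\mathbb{Z}(F)$ and $\frac{\partial x_j}{\partial x_i}=\delta_{ij}\mathrm{Id}_F$, where $\varepsilon:\mathbb{Z}(F)\to\mathbb{Z}$ is the additive homomorphism sending each element of $F$ to $1$. Let $\theta^\star:\mathbb{Z}(F)\to\mathbb{Z}(F/N)$ be the ring homomorphism extending $\theta$, and $\frac{\partial^\star w}{\partial x_i}=\theta^\star\big(\frac{\partial w}{\partial x_i}\big)$.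 Algebraic definition: for $w\in F$, $\varphi(w)=(f^{(w)},\theta(w))\in\mathbb{Z}^r\wr F/N$, where $f^{(w)}=(f_1^{(w)},\ldots,f_r^{(w)}):F/N\to\mathbb{Z}^r$ is determined by $\sum_{g\in F/N}f_i^{(w)}(g)\,g=\frac{\partial^\star w}{\partial x_i}\in\mathbb{Z}(F/N)$ for each $i$. (The kernel of $\varphi$ on $F$ is $N'=[N,N]$, and the induced injection on $F/N'$ is the Magnus embedding.) Geometric definition: let $\Gamma$ be the multigraph with vertex set $F/N$ and, for each $g\in F/N$ and $x\in X$, one edge $(g,x)$, labelled $x$, from $g$ to $gx$ (meaning $g\theta(x)$). For a word $w$ on $X\cup X^{-1}$ let $\rho_w$ be the path in $\Gamma$ starting at $\mathrm{Id}_{F/N}$ that reads $w$. Let $\pi_w(g,x)\in\mathbb{Z}$ be the net number of times $\rho_w$ traverses the edge $(g,x)$: each traversal from $g$ to $gx$ along $(g,x)$ counts $+1$, and each traversal from $gx$ to $g$ along $(g,x)$ counts $-1$. This depends only on the element of $F$ represented by $w$. Set $P_w(g)=\big(\pi_w(g,x_1),\ldots,\pi_w(g,x_r)\big)$, a function $F/N\to\mathbb{Z}^r$, and $\varphi_{\mathrm{geo}}(w)=(P_w,\theta(w))$. *)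

(* Defs.v *)
From HB Require Import structures.
From mathcomp Require Import ssreflect ssrfun ssrbool eqtype ssrnat seq choice.
From mathcomp Require Import generic_quotient fintype bigop finmap monoid.
From mathcomp Require Import ssralg ssrint matrix.
From mathcomp Require Import boolp classical_sets.
From mathcomp Require Import monalg.

Set Implicit Arguments.
Unset Strict Implicit.
Unset Printing Implicit Defensive.

Import GRing.Theory.

Local Open Scope quotient_scope.
Local Open Scope fset_scope.
Local Open Scope ring_scope.

(* Infinite groups: groupType of mathcomp.boot.monoid.  A subgroup is a
   boolean predicate, which is no restriction since boolp turns any Prop-valued
   predicate into a boolean one. *)
HB.mixin Record isConjClosed (G : groupType) (S : {pred G}) := {
  gpredJr : forall x y : G, x \in S -> (x ^ y)%g \in S
}.

#[short(type="normalSubgroup")]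
HB.structure Definition NormalSubgroup (G : groupType) :=
  {S of isConjClosed G S & GroupClosed G S}.

Section Quotient.
Variables (G : groupType) (N : normalSubgroup G).

Definition coset_rel (x y : G) : bool := (x^-1 * y)%g \in (N : {pred G}).

Lemma coset_rel_equiv : equiv_class_of coset_rel.
Proof.
split=> [x|x y|y x z]; rewrite /coset_rel.
- by rewrite mulVg gpred1.
- by rewrite -gpredV invgM invgK.
- by move=> xy yz; rewrite -[z](mulVKg y) mulgA gpredM.
Qed.

Canonical coset_equiv_rel := EquivRelPack coset_rel_equiv.

Definition quotient_group := {eq_quot coset_equiv_rel}.
HB.instance Definition _ := Choice.on quotient_group.
HB.instance Definition _ := EqQuotient.on quotient_group.

Definition quotient_map (x : G) : quotient_group := \pi_quotient_group x.

Lemma quotient_mapP x y :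
  reflect (quotient_map x = quotient_map y) ((x^-1 * y)%g \in (N : {pred G})).
Proof. exact: (eqmodP coset_equiv_rel). Qed.

Definition quotient_mul (a b : quotient_group) :=
  quotient_map (repr a * repr b)%g.
Definition quotient_inv (a : quotient_group) := quotient_map (repr a)^-1%g.

Lemma quotient_map_repr a : quotient_map (repr a) = a.
Proof. exact: reprK. Qed.

Lemma quotient_mulE x y :
  quotient_mul (quotient_map x) (quotient_map y) = quotient_map (x * y)%g.
Proof.
rewrite /quotient_mul.
set x' := repr _; set y' := repr _.
have /quotient_mapP hx : quotient_map x' = quotient_map x.
  exact: quotient_map_repr.
have /quotient_mapP hy : quotient_map y' = quotient_map y.
  exact: quotient_map_repr.
apply/quotient_mapP.
have -> : ((x' * y')^-1 * (x * y) = ((x'^-1 * x) ^ y') * (y'^-1 * y))%g.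
  by rewrite /conjg invgM !mulgA mulgK.
by rewrite gpredM ?gpredJr.
Qed.

Lemma quotient_invE x : quotient_inv (quotient_map x) = quotient_map x^-1%g.
Proof.
rewrite /quotient_inv; set x' := repr _.
have /quotient_mapP hx : quotient_map x' = quotient_map x.
  exact: quotient_map_repr.
apply/quotient_mapP; rewrite invgK -gpredV invgM invgK.
have -> : (x * x'^-1 = (x'^-1 * x) ^ x'^-1)%g by rewrite /conjg invgK !mulgA mulgV mul1g.
exact: gpredJr.
Qed.

Lemma quotient_ind (P : quotient_group -> Prop) :
  (forall x, P (quotient_map x)) -> forall a, P a.
Proof. by move=> h a; rewrite -(quotient_map_repr a). Qed.

Lemma quotient_mulA : associative quotient_mul.
Proof.
elim/quotient_ind=> x; elim/quotient_ind=> y; elim/quotient_ind=> z.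
by rewrite !quotient_mulE mulgA.
Qed.
Lemma quotient_mul1g : left_id (quotient_map 1%g) quotient_mul.
Proof. by elim/quotient_ind=> x; rewrite quotient_mulE mul1g. Qed.
Lemma quotient_mulg1 : right_id (quotient_map 1%g) quotient_mul.
Proof. by elim/quotient_ind=> x; rewrite quotient_mulE mulg1. Qed.
Lemma quotient_mulVg :
  left_inverse (quotient_map 1%g) quotient_inv quotient_mul.
Proof. by elim/quotient_ind=> x; rewrite quotient_invE quotient_mulE mulVg. Qed.
Lemma quotient_mulgV :
  right_inverse (quotient_map 1%g) quotient_inv quotient_mul.
Proof. by elim/quotient_ind=> x; rewrite quotient_invE quotient_mulE mulgV. Qed.

HB.instance Definition _ := isGroup.Build quotient_group
  quotient_mulA quotient_mul1g quotient_mulg1 quotient_mulVg quotient_mulgV.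

Fact quotient_map_is_morphism : monoid.monoid_morphism quotient_map.
Proof. by split=> // x y; rewrite -quotient_mulE. Qed.
HB.instance Definition _ := isUMagmaMorphism.Build G quotient_group
  quotient_map quotient_map_is_morphism.

Lemma quotient_map_ker x : (quotient_map x = 1%g) <-> x \in (N : {pred G}).
Proof.
have <- : quotient_map 1%g = 1%g by [].
split=> [/esym/quotient_mapP|h]; first by rewrite invg1 mul1g.
by apply/esym/quotient_mapP; rewrite invg1 mul1g.
Qed.

End Quotient.

(* {malg int[G]} is the group of finitely supported functions G -> int; monalg
   only makes it a ring for monoids without invertible elements, hence the
   separate ring structure on group_ring. *)
Definition group_ring (G : groupType) : Type := {malg int[G]}.

HB.instance Definition _ (G : groupType) := GRing.Zmodule.on (group_ring G).

Definition gring_of (G : groupType) (g : G) : group_ring G := << g >>.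

Section LinearExtension.
Variables (G : groupType) (V : zmodType) (f : G -> V).

(* The additive map on Z(G) that sends each g in G to f g. *)
Definition gring_ext (a : group_ring G) : V :=
  \sum_(g <- msupp a) f g *~ a@_g.

Lemma gring_extw (d : {fset G}) (a : group_ring G) : msupp a `<=` d ->
  gring_ext a = \sum_(g <- d) f g *~ a@_g.
Proof.
move=> le_d; rewrite /gring_ext (big_fset_incl _ le_d) //= => g _.
by move=> /mcoeff_outdom ->; rewrite mulr0z.
Qed.

Fact gring_ext_is_additive : zmod_morphism gring_ext.
Proof.
move=> a b; pose d := msupp a `|` msupp b.
rewrite !(@gring_extw d) ?fsubsetUl ?fsubsetUr ?(msuppB_le a b) //.
rewrite -sumrB; apply: eq_bigr => g _.
by rewrite (mcoeffB g a b) mulrzBr.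
Qed.
HB.instance Definition _ := GRing.isZmodMorphism.Build (group_ring G) V
  gring_ext gring_ext_is_additive.

Lemma gring_ext_of g : gring_ext (gring_of g) = f g.
Proof.
by rewrite /gring_ext /gring_of msuppU /= big_seq_fset1 mcoeffUU mulr1z.
Qed.

End LinearExtension.

Lemma malgU_gring (G : groupType) (g : G) (c : int) :
  << c *g g >> = gring_of g *~ c :> group_ring G.
Proof.
by rewrite /gring_of -raddfMz; congr << _ *g _ >>; rewrite intz.
Qed.

Lemma gring_expand (G : groupType) (a : group_ring G) :
  a = \sum_(g <- msupp a) gring_of g *~ a@_g.
Proof.
rewrite [LHS](monalgE (a : {malg int[G]})).
by apply: eq_bigr => g _; rewrite malgU_gring.
Qed.

Lemma gring_additive_eq (G : groupType) (V : zmodType)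
    (f f' : group_ring G -> V) : zmod_morphism f -> zmod_morphism f' ->
  (forall g, f (gring_of g) = f' (gring_of g)) -> f =1 f'.
Proof.
move=> fB f'B ff a.
pose m := GRing.isZmodMorphism.Build _ _ f fB.
pose m' := GRing.isZmodMorphism.Build _ _ f' f'B.
pose F : {additive group_ring G -> V} := HB.pack f m.
pose F' : {additive group_ring G -> V} := HB.pack f' m'.
rewrite -[f]/(F : _ -> _) -[f']/(F' : _ -> _) (gring_expand a) !raddf_sum.
by apply: eq_bigr => g _; rewrite !raddfMz /= ff.
Qed.

Section GroupRing.
Variable G : groupType.
Implicit Types a b c : group_ring G.

Definition gring_mul a b : group_ring G :=
  \sum_(g <- msupp a) \sum_(h <- msupp b) << a@_g * b@_h *g (g * h)%g >>.

Let lmul b (g : G) : group_ring G := gring_ext (fun h => gring_of (g * h)%g) b.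

Lemma gring_mulE a b : gring_mul a b = gring_ext (lmul b) a.
Proof.
apply: eq_bigr => g _; rewrite mulrz_suml; apply: eq_bigr => h _.
by rewrite malgU_gring -mulrzA mulrC.
Qed.

Fact gring_mulDl : left_distributive gring_mul +%R.
Proof. by move=> a b c; rewrite !gring_mulE raddfD. Qed.

Fact gring_mulDr : right_distributive gring_mul +%R.
Proof.
move=> a b c; rewrite !gring_mulE -big_split; apply: eq_bigr => g _ /=.
by rewrite /lmul raddfD mulrzDl.
Qed.

Let gring_mulBl a b c : gring_mul (a - b) c = gring_mul a c - gring_mul b c.
Proof. by rewrite !gring_mulE raddfB. Qed.

Let gring_mulBr a b c : gring_mul a (b - c) = gring_mul a b - gring_mul a c.
Proof. by apply: (addIr (gring_mul a c)); rewrite -gring_mulDr !subrK. Qed.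

Lemma gring_mul_of (g h : G) :
  gring_mul (gring_of g) (gring_of h) = gring_of (g * h)%g.
Proof. by rewrite gring_mulE !gring_ext_of /lmul gring_ext_of. Qed.

Fact gring_mulA : associative gring_mul.
Proof.
move=> a b c; move: a; apply: gring_additive_eq => [a a'|a a'|g].
- by rewrite gring_mulBl.
- by rewrite !gring_mulBl.
move: b; apply: gring_additive_eq => [b b'|b b'|h].
- by rewrite gring_mulBl gring_mulBr.
- by rewrite gring_mulBr gring_mulBl.
move: c; apply: gring_additive_eq => [c c'|c c'|k].
- by rewrite !gring_mulBr.
- by rewrite gring_mulBr.
by rewrite !gring_mul_of mulgA.
Qed.

Fact gring_mul1l : left_id (gring_of 1%g) gring_mul.
Proof.
apply: gring_additive_eq => [a a'|//|g]; first by rewrite gring_mulBr.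
by rewrite gring_mul_of mul1g.
Qed.

Fact gring_mul1r : right_id (gring_of 1%g) gring_mul.
Proof.
apply: gring_additive_eq => [a a'|//|g]; first by rewrite gring_mulBl.
by rewrite gring_mul_of mulg1.
Qed.

Fact gring_one_neq0 : gring_of (1%g : G) != 0.
Proof. by rewrite /gring_of monalgU_eq0. Qed.

HB.instance Definition _ := GRing.Zmodule_isNzRing.Build (group_ring G)
  gring_mulA gring_mul1l gring_mul1r gring_mulDl gring_mulDr gring_one_neq0.

Lemma gring_of1 : gring_of (1%g : G) = 1. Proof. by []. Qed.

Lemma gring_ofM (g h : G) : gring_of (g * h)%g = gring_of g * gring_of h.
Proof. by rewrite -gring_mul_of. Qed.

End GroupRing.

Section RingExtension.
Variables (G : groupType) (R : nzRingType) (f : G -> R).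
Hypotheses (f1 : f 1%g = 1) (fM : forall g h, f (g * h)%g = f g * f h).

Lemma gring_ext_monoid_morphism : monoid_morphism (gring_ext f).
Proof.
split=> [|a b]; first by rewrite -gring_of1 gring_ext_of.
move: a; apply: gring_additive_eq => [a a'|a a'|g].
- by rewrite mulrBl raddfB.
- by rewrite raddfB mulrBl.
move: b; apply: gring_additive_eq => [b b'|b b'|h].
- by rewrite mulrBr raddfB.
- by rewrite raddfB mulrBr.
by rewrite -gring_ofM !gring_ext_of fM.
Qed.

End RingExtension.

Section Augmentation.
Variable G : groupType.

Definition augmentation : group_ring G -> int := gring_ext (fun=> 1).
HB.instance Definition _ := GRing.Additive.on augmentation.
HB.instance Definition _ := GRing.isMonoidMorphism.Build _ _ augmentation
  (gring_ext_monoid_morphism (f := fun=> 1) erefl (fun _ _ => esym (mulr1 1))).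

Lemma augmentation_of g : augmentation (gring_of g) = 1.
Proof. exact: gring_ext_of. Qed.

End Augmentation.

Section GroupRingMap.
Variables (G H : groupType) (h : UMagmaMorphism.type G H).

Definition gring_map : group_ring G -> group_ring H :=
  gring_ext (fun g => gring_of (h g)).
HB.instance Definition _ := GRing.Additive.on gring_map.

Fact gring_map_monoid_morphism : monoid_morphism gring_map.
Proof.
by apply: gring_ext_monoid_morphism => [|g k];
  rewrite ?gmulf1 ?gmulfM ?gring_ofM.
Qed.
HB.instance Definition _ := GRing.isMonoidMorphism.Build _ _ gring_map
  gring_map_monoid_morphism.

Lemma gring_map_of g : gring_map (gring_of g) = gring_of (h g).
Proof. exact: gring_ext_of. Qed.

End GroupRingMap.

Section Wreath.
Variables (A : zmodType) (B : groupType).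

(* The base group A is abelian and written additively; {malg A[B]} is the
   group of finitely supported functions B -> A. *)
Definition wreath : Type := ({malg A[B]} * B)%type.
HB.instance Definition _ := Choice.on wreath.

Definition wreath_shift (b : B) (g : {malg A[B]}) : {malg A[B]} :=
  [malg x in [fset (b * y)%g | y in msupp g] => g@_(b^-1 * x)%g].

Lemma wreath_shiftE b g x : (wreath_shift b g)@_x = g@_(b^-1 * x)%g.
Proof.
rewrite mcoeffE; case: ifPn => // /negP h.
apply/esym/eqP; rewrite mcoeff_eq0; apply/negP => hx; apply: h.
by apply/imfsetP; exists (b^-1 * x)%g => //; rewrite mulVKg.
Qed.

Definition wreath_mul (u v : wreath) : wreath :=
  (u.1 + wreath_shift u.2 v.1, (u.2 * v.2)%g).
Definition wreath_one : wreath := (0, 1%g).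
Definition wreath_inv (u : wreath) : wreath :=
  (- wreath_shift u.2^-1%g u.1, u.2^-1%g).

Let malg_eq (f g : {malg A[B]}) : (forall x, f@_x = g@_x) -> f = g.
Proof. by move/malgP. Qed.

Fact wreath_mulA : associative wreath_mul.
Proof.
move=> u v w; congr pair; last exact: mulgA.
apply: malg_eq => x /=.
by rewrite !(mcoeffD, wreath_shiftE) invgM !mulgA addrA.
Qed.
Fact wreath_mul1 : left_id wreath_one wreath_mul.
Proof.
case=> f b; congr pair; last exact: mul1g.
by apply: malg_eq => x; rewrite !(mcoeffD, wreath_shiftE, mcoeff0) add0r invg1 mul1g.
Qed.
Fact wreath_mulr1 : right_id wreath_one wreath_mul.
Proof.
case=> f b; congr pair; last exact: mulg1.
by apply: malg_eq => x; rewrite !(mcoeffD, wreath_shiftE, mcoeff0) addr0.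
Qed.
Fact wreath_mulV : left_inverse wreath_one wreath_inv wreath_mul.
Proof.
case=> f b; congr pair; last exact: mulVg.
by apply: malg_eq => x; rewrite !(mcoeffD, mcoeffN, wreath_shiftE, mcoeff0) addNr.
Qed.
Fact wreath_mulVr : right_inverse wreath_one wreath_inv wreath_mul.
Proof.
case=> f b; congr pair; last exact: mulgV.
apply: malg_eq => x.
by rewrite !(mcoeffD, mcoeffN, wreath_shiftE, mcoeff0) invgK mulVKg addrN.
Qed.

HB.instance Definition _ := isGroup.Build wreath
  wreath_mulA wreath_mul1 wreath_mulr1 wreath_mulV wreath_mulVr.

End Wreath.

Definition free_basis (r : nat) (F : groupType) (x : 'I_r -> F) : Prop :=
  forall (H : groupType) (h : 'I_r -> H),
    exists f : UMagmaMorphism.type F H,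
      (forall i, f (x i) = h i) /\
      (forall f' : UMagmaMorphism.type F H,
         (forall i, f' (x i) = h i) -> f' =1 f).

(* The letter (i, true) stands for x_i and (i, false) for its inverse. *)
Definition word (r : nat) := seq ('I_r * bool).

Definition letter_val (r : nat) (F : groupType) (x : 'I_r -> F)
    (l : 'I_r * bool) : F :=
  if l.2 then x l.1 else (x l.1)^-1%g.

Definition word_val (r : nat) (F : groupType) (x : 'I_r -> F) (s : word r) : F :=
  foldr (fun l g => (letter_val x l * g)%g) 1%g s.

Section Words.
Variables (r : nat) (F : groupType) (x : 'I_r -> F).

Lemma word_val_cat (s t : word r) :
  word_val x (s ++ t) = (word_val x s * word_val x t)%g.
Proof. by elim: s => [|l s IHs] /=; rewrite ?mul1g // IHs mulgA. Qed.

Lemma word_val_rev (s : word r) :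
  word_val x [seq (l.1, ~~ l.2) | l <- rev s] = (word_val x s)^-1%g.
Proof.
elim: s => [|[i b] s IHs]; first by rewrite /= invg1.
rewrite rev_cons map_rcons -cats1 word_val_cat {}IHs /= invgM mulg1.
by congr (_ * _)%g; case: b; rewrite /letter_val /= ?invgK.
Qed.

Definition is_word_val : {pred F} := fun w => `[< exists s, word_val x s = w >].

Record word_subgroup :=
  WordSubgroup { word_subgroup_val : F; _ : word_subgroup_val \in is_word_val }.
HB.instance Definition _ := [isSub for word_subgroup_val].
HB.instance Definition _ := [Choice of word_subgroup by <:].

Fact is_word_val_group_closed : group_closed is_word_val.
Proof.
split=> [|u v /asboolP [s <-] /asboolP [t <-]]; apply/asboolP; first by exists [::].
by exists (s ++ [seq (l.1, ~~ l.2) | l <- rev t]);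
  rewrite word_val_cat word_val_rev.
Qed.
HB.instance Definition _ := SubChoice_isSubGroup.Build F is_word_val
  word_subgroup is_word_val_group_closed.

Hypothesis x_free : free_basis x.

Lemma free_basis_word (w : F) : exists s, word_val x s = w.
Proof.
have xP i : x i \in is_word_val.
  by apply/asboolP; exists [:: (i, true)]; rewrite /= mulg1.
have [f [fx _]] := x_free (fun i => WordSubgroup (xP i)).
have [g [_ g_uniq]] := x_free x.
pose vf : UMagmaMorphism.type F F := (val : word_subgroup -> F) \o f.
have vfE : vf =1 g by apply: g_uniq => i /=; rewrite fx.
have idE : idfun =1 g by apply: g_uniq.
have -> : w = val (f w) by rewrite -[LHS]/(idfun w) idE -vfE.
exact/asboolP/(valP (f w)).
Qed.

End Words.

Definition word_of (r : nat) (F : groupType) (x : 'I_r -> F) (w : F) : word r :=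
  xget [::] [set s | word_val x s = w]%classic.

Lemma word_ofK (r : nat) (F : groupType) (x : 'I_r -> F) :
  free_basis x -> cancel (word_of x) (word_val x).
Proof.
move=> x_free w; rewrite /word_of.
exact: (xgetPex [::] (free_basis_word x_free w)).
Qed.

Lemma word_val_morph (r : nat) (F H : groupType) (x : 'I_r -> F)
    (f : UMagmaMorphism.type F H) (s : word r) :
  f (word_val x s) = word_val (f \o x) s.
Proof.
elim: s => [|[i b] s IHs] /=; first exact: gmulf1.
by rewrite gmulfM IHs; congr (_ * _)%g; case: b; rewrite /letter_val //= gmulfV.
Qed.

Section Fox.
Variables (r : nat) (F : groupType) (x : 'I_r -> F).

Record is_fox_derivative (i : 'I_r) (D : group_ring F -> group_ring F) : Prop :=
  IsFoxDerivative {
    fox_additive : forall a b, D (a + b) = D a + D b;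
    fox_product : forall a b, D (a * b) = D a * (augmentation b)%:~R + a * D b;
    fox_basis : forall j, D (gring_of (x j)) = (i == j)%:R
  }.

(* Existence and uniqueness: fox_derivativeP and fox_derivative_unique below. *)
Definition fox_derivative (i : 'I_r) : group_ring F -> group_ring F :=
  xget (fun=> 0) [set D | is_fox_derivative i D]%classic.

Hypothesis x_free : free_basis x.

Lemma wreath_shift_gring (g : F) (a : group_ring F) :
  wreath_shift g (a : {malg int[F]}) = gring_of g * a.
Proof.
move: a; apply: gring_additive_eq => [a b|a b|h].
- by apply/malgP => y; rewrite !(wreath_shiftE, mcoeffB).
- by rewrite mulrBr.
rewrite -gring_ofM; apply/malgP => y; rewrite wreath_shiftE !mcoeffU.
by rewrite -(inj_eq (mulgI g)) mulVKg.
Qed.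

Lemma fox_derivative_exists i : exists D, is_fox_derivative i D.
Proof.
have [f [fx _]] := x_free
  (fun j => ((i == j)%:R : group_ring F, x j) : wreath int F).
have f2 w : (f w).2 = w.
  have [s <-] := free_basis_word x_free w.
  elim: s => [|[j b] s IHs] /=; first by rewrite gmulf1.
  rewrite gmulfM /= IHs; congr (_ * _)%g.
  by case: b; rewrite /letter_val /= ?gmulfV ?fx.
pose D := gring_ext (fun w => (f w).1 : group_ring F).
have DB : zmod_morphism D by exact: raddfB.
have D_of w : D (gring_of w) = (f w).1 by exact: gring_ext_of.
exists D; split=> [a b|a b|j]; first exact: raddfD.
- move: a; apply: gring_additive_eq => [a a'|a a'|g].
  + by rewrite mulrBl DB.
  + by rewrite DB !mulrBl addrACA opprD.
  move: b; apply: gring_additive_eq => [b b'|b b'|h].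
  + by rewrite mulrBr DB.
  + by rewrite DB raddfB intrB !mulrBr addrACA opprD.
  rewrite -gring_ofM !D_of augmentation_of mulr1 gmulfM /=.
  by rewrite f2 wreath_shift_gring.
by rewrite D_of fx.
Qed.

Lemma fox_derivativeP i : is_fox_derivative i (fox_derivative i).
Proof. exact: (xgetPex (fun=> 0) (fox_derivative_exists i)). Qed.

Lemma fox_derivative_unique i D : is_fox_derivative i D ->
  D =1 fox_derivative i.
Proof.
have fB E : is_fox_derivative i E -> zmod_morphism E.
  by move=> h a b; apply: (addIr (E b)); rewrite -(fox_additive h) !subrK.
have f1 E : is_fox_derivative i E -> E 1 = 0.
  move=> h; have := fox_product h 1 1.
  by rewrite rmorph1 !mulr1 mul1r -[LHS]addr0 => /addrI.
move=> hD; have hE := fox_derivativeP i.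
apply: gring_additive_eq (fB _ hD) (fB _ hE) _ => w.
have [s <-] := free_basis_word x_free w.
elim: s => [|[j b] s IHs]; first by rewrite gring_of1 !f1.
rewrite /= gring_ofM (fox_product hD) (fox_product hE) {}IHs; congr (_ * _ + _).
case: b => /=; rewrite /letter_val /=; first by rewrite (fox_basis hD) (fox_basis hE).
have inv E : is_fox_derivative i E ->
    E (gring_of (x j)^-1%g) = - gring_of (x j)^-1%g * (i == j)%:R.
  move=> h; apply: (addIr (gring_of (x j)^-1%g * (i == j)%:R)).
  have := fox_product h (gring_of (x j)^-1%g) (gring_of (x j)).
  rewrite -gring_ofM mulVg gring_of1 (f1 _ h) augmentation_of mulr1.
  by rewrite (fox_basis h) mulNr addNr => <-.
by rewrite (inv _ hD) (inv _ hE).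
Qed.

End Fox.

Section Components.
Variables (r : nat) (Q : groupType) (a : 'I_r -> group_ring Q).

(* The function Q -> Z^r whose i-th component is g |-> (a i)@_g. *)
Definition row_of_components : {malg 'rV[int]_r[Q]} :=
  [malg g in (\bigcup_(i <- enum 'I_r) msupp (a i))%fset => \row_i (a i)@_g].

Lemma row_of_componentsE g i : row_of_components@_g ord0 i = (a i)@_g.
Proof.
rewrite mcoeffE; case: ifPn => h; first by rewrite mxE.
rewrite mxE; apply/esym/mcoeff_outdom; apply: contra h => h.
by apply/bigfcupP; exists i => //; rewrite mem_enum.
Qed.

End Components.

Section Cayley.
Variables (r : nat) (Q : groupType) (t : 'I_r -> Q).

(* The multigraph with vertex set Q and, for each g and i, one edge (g, i)
   from g to g * t i. *)
Definition edge : Type := (Q * 'I_r)%type.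
HB.instance Definition _ := Choice.on edge.

Definition edge_src (e : edge) : Q := e.1.
Definition edge_tgt (e : edge) : Q := (e.1 * t e.2)%g.

(* (e, true) traverses e from edge_src e to edge_tgt e, (e, false) backwards. *)
Definition traversal : Type := (edge * bool)%type.
HB.instance Definition _ := Choice.on traversal.

Definition trav_src (p : traversal) : Q :=
  if p.2 then edge_src p.1 else edge_tgt p.1.
Definition trav_tgt (p : traversal) : Q :=
  if p.2 then edge_tgt p.1 else edge_src p.1.

(* The traversal leaving g that reads the letter l. *)
Definition letter_trav (g : Q) (l : 'I_r * bool) : traversal :=
  if l.2 then ((g, l.1), true) else (((g * (t l.1)^-1)%g, l.1), false).

Fixpoint path_from (g : Q) (s : word r) : seq traversal :=
  if s is l :: s' then
    letter_trav g l :: path_from (trav_tgt (letter_trav g l)) s'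
  else [::].

Lemma letter_trav_src g l : trav_src (letter_trav g l) = g.
Proof. by case: l => i []; rewrite /trav_src //= /edge_tgt /= mulgVK. Qed.

Lemma letter_trav_tgt g l : trav_tgt (letter_trav g l) = (g * letter_val t l)%g.
Proof. by case: l => i []. Qed.

Definition word_path (s : word r) : seq traversal := path_from 1%g s.

Definition net_count (ps : seq traversal) (e : edge) : int :=
  (count_mem ((e, true) : traversal) ps)%:Z -
  (count_mem ((e, false) : traversal) ps)%:Z.

Definition word_flow (s : word r) (e : edge) : int := net_count (word_path s) e.

Definition flow_fun (s : word r) : {malg 'rV[int]_r[Q]} :=
  [malg g in [fset p.1.1 | p in word_path s] => \row_i word_flow s (g, i)].

Lemma net_count_notin ps g i :
  g \notin [fset p.1.1 | p in ps] -> net_count ps (g, i) = 0.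
Proof.
move=> h; rewrite /net_count.
have h0 b : count_mem (((g, i), b) : traversal) ps = 0%N.
  apply/count_memPn; apply: contra h => h.
  by apply/imfsetP; exists ((g, i), b).
by rewrite !h0.
Qed.

Lemma flow_funE s g i : (flow_fun s)@_g ord0 i = word_flow s (g, i).
Proof.
rewrite mcoeffE; case: ifPn => h; rewrite mxE //.
by rewrite /word_flow net_count_notin.
Qed.

Lemma net_count_cons p ps e :
  net_count (p :: ps) e = net_count [:: p] e + net_count ps e.
Proof. by rewrite /net_count /= !addn0 !PoszD opprD addrACA. Qed.

Lemma net_count_translate h g y i s :
  net_count (path_from (h * g)%g s) ((h * y)%g, i) =
  net_count (path_from g s) (y, i).
Proof.
elim: s g => // l s IHs g; rewrite /= net_count_cons [RHS]net_count_cons.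
rewrite !letter_trav_tgt -mulgA IHs; congr (_ + _).
rewrite /net_count /letter_trav.
by case: l.2; rewrite /= !addn0 !xpair_eqE -?mulgA !(inj_eq (mulgI h)).
Qed.

Lemma word_flow_cons l s g i :
  word_flow (l :: s) (g, i) =
  word_flow [:: l] (g, i) + word_flow s (((letter_val t l)^-1 * g)%g, i).
Proof.
rewrite /word_flow /word_path /= net_count_cons letter_trav_tgt; congr (_ + _).
by rewrite -{1}[g](mulVKg (letter_val t l)) mul1g -{1}[letter_val t l]mulg1
  net_count_translate.
Qed.

Lemma flow_fun_cons l s :
  flow_fun (l :: s) = flow_fun [:: l] + wreath_shift (letter_val t l) (flow_fun s).
Proof.
apply/malgP => g; apply/rowP => i.
by rewrite mcoeffD mxE wreath_shiftE !flow_funE word_flow_cons.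
Qed.

(* Value of the geometric embedding on the generator i. *)
Definition edge_wreath (i : 'I_r) : wreath 'rV[int]_r Q :=
  (<< delta_mx ord0 i *g 1%g >>, t i).

Lemma flow_fun_letter l :
  letter_val edge_wreath l = (flow_fun [:: l], letter_val t l).
Proof.
case: l => i b; rewrite [LHS]surjective_pairing; congr pair; last by case: b.
apply/malgP => g; apply/rowP => j; rewrite flow_funE /word_flow /word_path.
case: b; rewrite /net_count /letter_val /= !addn0 !xpair_eqE /= ?andbT ?andbF.
  rewrite subr0 mcoeffU; case: eqP => _ /=; last by rewrite mulr0n mxE.
  by rewrite mulr1n mxE eqxx eq_sym natz.
rewrite mul1g sub0r mcoeffN wreath_shiftE invgK mcoeffU mxE.
rewrite -[_ == g](inj_eq (mulgI (t i))) mulgV; case: eqP => _ /=.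
  by rewrite mulr1n mxE eqxx eq_sym natz.
by rewrite mulr0n mxE.
Qed.

Lemma flow_wreathE s : word_val edge_wreath s = (flow_fun s, word_val t s).
Proof.
elim: s => [|l s IHs] /=.
  congr pair; apply/malgP => g; apply/rowP => i.
  by rewrite flow_funE /word_flow /word_path /net_count mcoeff0 mxE subrr.
by rewrite IHs flow_fun_letter [flow_fun (l :: s)]flow_fun_cons.
Qed.

End Cayley.

Lemma flow_fun_indep (r : nat) (F Q : groupType) (x : 'I_r -> F) (t : 'I_r -> Q)
    (s s' : word r) : free_basis x -> word_val x s = word_val x s' ->
  flow_fun t s = flow_fun t s'.
Proof.
move=> x_free ss'; have [f [fx _]] := x_free _ (edge_wreath t).
have fE u : f (word_val x u) = (flow_fun t u, word_val t u).
  rewrite word_val_morph -flow_wreathE; congr word_val.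
  exact/funext.
by have := congr1 fst (fE s); rewrite ss' fE.
Qed.

Section Magnus.
Variables (r : nat) (F : groupType) (x : 'I_r -> F) (N : normalSubgroup F).

Local Notation theta := (quotient_map N).

Definition fox_star (i : 'I_r) (w : F) : group_ring (quotient_group N) :=
  gring_map theta (fox_derivative x i (gring_of w)).

Definition magnus_fun (w : F) : {malg 'rV[int]_r[quotient_group N]} :=
  row_of_components (fox_star^~ w).

Definition magnus (w : F) : wreath 'rV[int]_r (quotient_group N) :=
  (magnus_fun w, theta w).

Lemma magnus_funP w i :
  \sum_(g <- msupp (magnus_fun w)) gring_of g *~ (magnus_fun w)@_g ord0 i =
  fox_star i w.
Proof.
have le_supp : msupp (fox_star i w) `<=` msupp (magnus_fun w).
  apply/fsubsetP => g; rewrite -!mcoeff_neq0; apply: contra_neq => g0.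
  by rewrite -(row_of_componentsE (fox_star^~ w)) [_@_g]g0 mxE.
rewrite [RHS](monalgEw le_supp); apply: eq_bigr => g _.
by rewrite malgU_gring row_of_componentsE.
Qed.

(* The chosen word word_of x w is immaterial: see geo_funE. *)
Definition geo_fun (w : F) : {malg 'rV[int]_r[quotient_group N]} :=
  flow_fun (theta \o x) (word_of x w).

Definition magnus_geo (w : F) : wreath 'rV[int]_r (quotient_group N) :=
  (geo_fun w, theta w).

Lemma geo_funE (s : word r) g i : free_basis x ->
  (geo_fun (word_val x s))@_g ord0 i = word_flow (theta \o x) s (g, i).
Proof.
move=> x_free; rewrite -flow_funE /geo_fun.
by rewrite (flow_fun_indep _ x_free (word_ofK x_free (word_val x s))).
Qed.

End Magnus.

(* Main.v *)
Require Import Defs.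
From HB Require Import structures.
From mathcomp Require Import ssreflect ssrfun ssrbool eqtype ssrnat seq choice.
From mathcomp Require Import fintype monoid ssralg ssrint matrix.
From mathcomp Require Import boolp monalg.

(** Both embeddings are the homomorphism from [F] to the wreath product that
    sends the basis element [x i] to [edge_wreath (quotient_map N \o x) i].

    On the Fox side, the product rule on group elements reads
    [D (u v) = D u + u D v], because the augmentation of [v] is 1; after
    projecting to [F / N], multiplication by [u] becomes translation by its
    class, so this is exactly the multiplication of the wreath product
    ([magnusM]).  Together with [D_i x_j = delta_ij] this identifies the Magnus
    embedding on the basis ([magnus_basis]).

    On the geometric side, putting a letter in front of a word traverses one
    edge at the identity and then the path of the word, translated by the class
    of that letter.  Hence the flow of a word is the product, in the wreath
    product, of the values of its letters ([flow_wreathE]).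

    A homomorphism is computed letter by letter on a word ([word_val_morph]),
    so evaluating the Magnus embedding along the word chosen to define the flow
    of [w] gives the theorem. *)

Import GRing.Theory.
Local Open Scope ring_scope.

Section MagnusMorphism.
Variables (r : nat) (F : groupType) (x : 'I_r -> F) (N : normalSubgroup F).
Hypothesis x_free : free_basis x.

Local Notation theta := (quotient_map N).

Lemma fox_starM i u v :
  fox_star x N i (u * v)%g =
  fox_star x N i u + gring_of (theta u) * fox_star x N i v.
Proof.
rewrite /fox_star gring_ofM (fox_product (fox_derivativeP x_free i)).
by rewrite augmentation_of mulr1 rmorphD rmorphM /= gring_map_of.
Qed.

Lemma fox_star_basis i j : fox_star x N i (x j) = (i == j)%:R.
Proof.
by rewrite /fox_star (fox_basis (fox_derivativeP x_free i)) rmorph_nat.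
Qed.

(** The twist by [u] in the product rule for Fox derivatives is the action of
    [F / N] by translation in the wreath product. *)
Lemma magnusM : {morph magnus x N : u v / (u * v)%g}.
Proof.
move=> u v; congr pair; last exact: gmulfM.
apply/malgP => g; apply/rowP => i.
rewrite mcoeffD mxE wreath_shiftE !row_of_componentsE fox_starM.
by rewrite -wreath_shift_gring mcoeffD wreath_shiftE.
Qed.

Lemma magnus1 : magnus x N 1%g = 1%g.
Proof. by apply: (mulgI (magnus x N 1%g)); rewrite -magnusM !mulg1. Qed.

Lemma magnus_basis i : magnus x N (x i) = edge_wreath (theta \o x) i.
Proof.
congr pair; apply/malgP => g; apply/rowP => j.
rewrite row_of_componentsE fox_star_basis mcoeffU.
case: (j =P i) => [->|/eqP/negPf ji].
  rewrite -gring_of1 mcoeffU; case: (1%g == g); last by rewrite mxE.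
  by rewrite mxE !eqxx.
by rewrite mcoeff0; case: (1%g == g); rewrite mxE // ji andbF.
Qed.

Lemma magnus_word_val s :
  magnus x N (word_val x s) = word_val (edge_wreath (theta \o x)) s.
Proof.
pose m := isUMagmaMorphism.Build _ _ (magnus x N) (conj magnus1 magnusM).
pose M : UMagmaMorphism.type F _ := HB.pack (magnus x N) m.
rewrite -[LHS]/(M (word_val x s)) word_val_morph; congr word_val.
exact/funext/magnus_basis.
Qed.

End MagnusMorphism.

Theorem theorem3p1 (r : nat) (F : groupType) (x : 'I_r -> F)
    (x_free : free_basis x) (N : normalSubgroup F) :
  forall w : F, magnus x N w = magnus_geo x N w.
Proof.
move=> w; congr pair.
have := magnus_word_val _ _ _ N x_free (word_of x w).
by rewrite word_ofK // flow_wreathE => /(congr1 fst).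
Qed.
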